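(* Let $\Bbbk$ be an algebraically closed field of characteristic $p>0$ and let $H$ be a $p^2$-dimensional Hopf algebra over $\Bbbk$ which admits a nonzero primitive element. Then $\dim H_0\le p$.
   Context: An element $x\in H$ is primitive if $\Delta(x)=x\otimes 1+1\otimes x$. The coradical $H_0$ is the sum of all simple subcoalgebras of $H$. *)

(* Defs.v *)
From HB Require Import structures.
From mathcomp Require Import all_boot all_order all_algebra all_field.
From mathcomp Require Import boolp.

Set Implicit Arguments.
Unset Strict Implicit.
Unset Printing Implicit Defensive.

Import GRing.Theory.

Local Open Scope ring_scope.

Section TensorProduct.
Variable K : fieldType.
Implicit Types U V W : vectType K.

(* Coordinates are taken in the bases [vbasis {:U}], [vbasis {:V}];
   [tlift_tens] and [tprod_ebasis] give the universal property, so nothing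
   below depends on that choice. *)
Definition tprod U V : vectType K := 'M[K]_(\dim {:U}, \dim {:V}).

Definition tens U V (u : U) (v : V) : tprod U V :=
  \matrix_(i, j) (coord (vbasis {:U}) i u * coord (vbasis {:V}) j v).

Definition ebasis V (i : 'I_(\dim {:V})) : V := (vbasis {:V})`_i.

(* The linear map on the tensor product induced by a bilinear map [f]. *)
Definition tlift U V W (f : U -> V -> W) (t : tprod U V) : W :=
  \sum_i \sum_j (t : 'M_(_, _)) i j *: f (ebasis i) (ebasis j).

Definition tmap U U' V V' (f : U -> U') (g : V -> V') :
    tprod U V -> tprod U' V' :=
  tlift (fun u v => tens (f u) (g v)).

Definition tassoc U V W : tprod (tprod U V) W -> tprod U (tprod V W) :=
  tlift (fun t w => tlift (fun u v => tens u (tens v w)) t).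

Lemma tens_linearl U V (v : V) : linear (fun u : U => tens u v).
Proof.
move=> a u1 u2; apply/matrixP=> i j.
by rewrite !mxE linearP /= mulrDl mulrA.
Qed.

Lemma tens_linearr U V (u : U) : linear (fun v : V => tens u v).
Proof.
move=> a v1 v2; apply/matrixP=> i j.
by rewrite !mxE linearP /= mulrDr mulrCA.
Qed.

Lemma ebasis_sum V (v : V) :
  v = \sum_i coord (vbasis {:V}) i v *: ebasis i.
Proof. exact: coord_vbasis (memvf v). Qed.

Lemma tprod_ebasis U V (t : tprod U V) :
  t = \sum_i \sum_j (t : 'M_(_, _)) i j *: tens (ebasis i) (ebasis j).
Proof.
rewrite {1}[t]matrix_sum_delta; apply: eq_bigr => i _; apply: eq_bigr => j _.
congr (_ *: _); apply/matrixP=> k l; rewrite !mxE.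
have fB (W : vectType K) : free (vbasis {:W}).
  exact: basis_free (vbasisP _).
by rewrite !coord_free // -natrM mulnb (eq_sym i) (eq_sym j).
Qed.

Lemma tlift_is_linear U V W (f : U -> V -> W) : linear (tlift f).
Proof.
move=> a s t; rewrite /tlift scaler_sumr -big_split; apply: eq_bigr => i _ /=.
rewrite scaler_sumr -big_split; apply: eq_bigr => j _ /=.
by rewrite !mxE scalerDl scalerA.
Qed.

HB.instance Definition _ U V W (f : U -> V -> W) :=
  GRing.isLinear.Build K (tprod U V) W _ (tlift f) (tlift_is_linear f).

Lemma tlift_tens U V W (f : U -> V -> W) (u : U) (v : V) :
    (forall v', linear (f^~ v')) -> (forall u', linear (f u')) ->
  tlift f (tens u v) = f u v.
Proof.
move=> fl fr.
pose fL v' : {linear U -> W} :=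
  HB.pack (f^~ v') (GRing.isLinear.Build K U W _ (f^~ v') (fl v')).
pose fR u' : {linear V -> W} :=
  HB.pack (f u') (GRing.isLinear.Build K V W _ (f u') (fr u')).
rewrite [RHS](_ : _ = fL v u) // {2}(ebasis_sum u) linear_sum.
apply: eq_bigr => i _; rewrite linearZ /=.
rewrite [f (ebasis i) v](_ : _ = fR (ebasis i) v) // {2}(ebasis_sum v).
rewrite linear_sum scaler_sumr; apply: eq_bigr => j _; rewrite linearZ /=.
by rewrite scalerA mxE.
Qed.

(* The image of X ⊗ Y in U ⊗ V. *)
Definition tprodv U V (X : {vspace U}) (Y : {vspace V}) : {vspace tprod U V} :=
  <<[seq tens x y | x <- vbasis X, y <- vbasis Y]>>%VS.

End TensorProduct.

Definition tmul (K : fieldType) (A : falgType K) (s t : tprod A A) :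
    tprod A A :=
  tlift (fun a b => tlift (fun c d => tens (a * c) (b * d)) t) s.

HB.mixin Record Vector_isCoalgebra (K : fieldType) C of Vector K C := {
  comul : {linear C -> tprod C C};
  counit : {linear C -> K^o};
  comulA : forall x : C,
    tassoc (tmap comul idfun (comul x)) = tmap idfun comul (comul x);
  comul_counitl : forall x : C,
    tlift (fun a b : C => counit a *: b) (comul x) = x;
  comul_counitr : forall x : C,
    tlift (fun a b : C => counit b *: a) (comul x) = x
}.

#[short(type="coalgType")]
HB.structure Definition Coalgebra (K : fieldType) :=
  { C of Vector_isCoalgebra K C & Vector K C }.

HB.mixin Record FalgCoalgebra_isBialgebra (K : fieldType) B
    of Falgebra K B & Coalgebra K B := {
  comulM : forall x y : B, comul (x * y) = tmul (comul x) (comul y);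
  comul1 : comul (1 : B) = tens 1 1;
  counitM : forall x y : B, counit (x * y) = counit x * counit y;
  counit1 : counit (1 : B) = 1
}.

#[short(type="bialgType")]
HB.structure Definition Bialgebra (K : fieldType) :=
  { B of FalgCoalgebra_isBialgebra K B & Falgebra K B & Coalgebra K B }.

HB.mixin Record Bialgebra_isHopf (K : fieldType) H of Bialgebra K H := {
  antipode : {linear H -> H};
  antipodel : forall x : H,
    tlift (fun a b : H => antipode a * b) (comul x) = counit x *: 1;
  antipoder : forall x : H,
    tlift (fun a b : H => a * antipode b) (comul x) = counit x *: 1
}.

(* Finite-dimensional Hopf algebras over K. *)
#[short(type="hopfAlgType")]
HB.structure Definition HopfAlgebra (K : fieldType) :=
  { H of Bialgebra_isHopf K H & Bialgebra K H }.

Definition primitive_elt (K : fieldType) (H : hopfAlgType K) (x : H) : Prop :=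
  comul x = tens x 1 + tens 1 x.

Definition subcoalgebra (K : fieldType) (C : coalgType K) (D : {vspace C}) :
    Prop :=
  forall x, x \in D -> comul x \in tprodv D D.

Definition simple_subcoalgebra (K : fieldType) (C : coalgType K)
    (D : {vspace C}) : Prop :=
  [/\ subcoalgebra D, D <> 0%VS &
      forall E : {vspace C}, subcoalgebra E -> (E <= D)%VS ->
        E = 0%VS \/ E = D].

Lemma sumv_family_ex (K : fieldType) (V : vectType K)
    (P : {vspace V} -> Prop) :
  exists S : {vspace V}, forall v, v \in S <->
    exists2 Us : seq {vspace V}, (forall U, U \in Us -> P U)
      & v \in (\sum_(U <- Us) U)%VS.
Proof.
pose Q n := `[< exists2 Us : seq {vspace V}, (forall U, U \in Us -> P U)
  & \dim (\sum_(U <- Us) U)%VS = n >].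
have Q0 : exists n, Q n.
  by exists 0%N; apply/asboolP; exists [::]; rewrite // big_nil dimv0.
have Qle n : Q n -> (n <= \dim {:V})%N.
  by case/asboolP=> Us _ <-; rewrite dimvS ?subvf.
case: (ex_maxnP Q0 Qle) => n /asboolP[Us PUs dimUs] maxn.
exists (\sum_(U <- Us) U)%VS => v; split=> [vU | [Ws PWs]]; first by exists Us.
have /eqP/esym eqU :
    (\sum_(U <- Us) U == \sum_(U <- Us ++ Ws) U)%VS.
  rewrite eqEdim big_cat addvSl dimUs; apply/maxn/asboolP.
  exists (Us ++ Ws); last by rewrite big_cat.
  by move=> U; rewrite mem_cat => /orP[/PUs | /PWs].
by move=> vWs; rewrite -eqU big_cat; apply: subvP (addvSr _ _) _ vWs.
Qed.

(* The sum of all subspaces satisfying P; [sumv_family_ex] is needed because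
   the big operators only range over finite families. *)
Definition sumv_family (K : fieldType) (V : vectType K)
    (P : {vspace V} -> Prop) : {vspace V} :=
  sval (cid (sumv_family_ex P)).

Lemma sumv_familyP (K : fieldType) (V : vectType K) (P : {vspace V} -> Prop) v :
  v \in sumv_family P <->
    exists2 Us : seq {vspace V}, (forall U, U \in Us -> P U)
      & v \in (\sum_(U <- Us) U)%VS.
Proof. exact: (svalP (cid (sumv_family_ex P))). Qed.

Definition coradical (K : fieldType) (C : coalgType K) : {vspace C} :=
  sumv_family (@simple_subcoalgebra K C).
Arguments coradical {K} C.

(* Main.v *)
From HB Require Import structures.
Require Import Defs.
From mathcomp Require Import all_boot all_order all_algebra all_field.
From mathcomp Require Import boolp.
Import GRing.Theory.
Local Open Scope ring_scope.

Set Implicit Arguments.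
Unset Strict Implicit.
Unset Printing Implicit Defensive.

(* Let [x] be a nonzero primitive element and [S] the sum of the simple left
   coideals of [H]; [S] contains the coradical, so it suffices to show
   [p * dim S <= p ^ 2], i.e. that the sum of the [S * x ^ i], [i < p], is direct
   with [dim S]-dimensional summands.  Comparing coproducts reduces this to: no
   nonzero [b] in [S] has [b * x] in [S].

   Otherwise some simple left coideal [V] satisfies [V * x <= S].  Let [Psi] be
   right multiplication by [x] on [V] followed by an equivariant retraction of
   [S] onto [V], and let [f] be a functional that is an eigenvector of the
   transpose of [Psi].  Then [W], the image of [V] under [v |-> v1 f(v2)], is a
   nonzero left coideal with [W * x <= W], so a monic polynomial of degree
   [dim W] in [x] annihilates [W], and hence vanishes because
   [antipode(w1) w2 = eps(w)].  As [1, x, .., x ^ (p - 1)] are linearly independent,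
   [dim W >= p].  But [dim V < p]: by Schur's lemma the [V]-isotypic part of [H]
   has dimension [(dim V) ^ 2], and it misses [1] unless [dim V = 1]. *)

(** * Modules over a family of operators *)

Lemma eigenvector_closed (k : closedFieldType) (M : vectType k)
    (T : 'End(M)) (V : {vspace M}) :
  V != 0%VS -> (T @: V <= V)%VS ->
  exists a v, [/\ v \in V, v != 0 & T v = a *: v].
Proof.
move=> V0 TV; pose b := vbasis V; pose n := \dim V.
pose A : 'M[k]_n := \matrix_(i, j) coord b j (T b`_i).
have bV (i : 'I_n) : b`_i \in V by rewrite vbasis_mem ?mem_nth ?size_tuple.
have [a ra] : exists a, root (char_poly A) a.
  by apply/closed_rootP; rewrite size_char_poly eqSS dimv_eq0.
have := ra; rewrite -eigenvalue_root_char => /eigenvalueP[u uA u0].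
exists a, (\sum_i u 0 i *: b`_i); split.
- by apply: memv_suml => i _; rewrite memvZ.
- apply: contra_neq u0 => u0; apply/rowP=> i; rewrite mxE.
  by have /freeP/(_ (fun i => u 0 i) u0 i) := basis_free (vbasisP V).
rewrite linear_sum scaler_sumr.
under eq_bigr => i _.
  rewrite linearZ /= (coord_vbasis (subvP TV _ (memv_img T (bV i)))).
  rewrite scaler_sumr; over.
rewrite exchange_big /=; apply: eq_bigr => j _.
under eq_bigr do rewrite scalerA; rewrite -scaler_suml scalerA; congr (_ *: _).
by have /rowP/(_ j) := uA; rewrite !mxE => <-; apply: eq_bigr => i _; rewrite mxE.
Qed.

Section OperatorModules.
Variables (K : fieldType) (M : vectType K) (I : Type) (op : I -> 'End(M)).
Implicit Types (U V : {vspace M}) (T : 'End(M)).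

Definition stable U := forall i, {in U, forall u, op i u \in U}.

Definition simple V :=
  [/\ stable V, V != 0%VS & forall U, stable U -> (U <= V)%VS ->
    U != 0%VS -> U = V].

(** Commutation is asked on [V] only, because the retraction of [simple_retract] is known to commute
    with the operators on the socle and not beyond it. *)
Definition equivariant V T := forall i, {in V, forall v, T (op i v) = op i (T v)}.

Definition socle : {vspace M} := sumv_family simple.

Lemma stable_cap U V : stable U -> stable V -> stable (U :&: V).
Proof. by move=> sU sV i u; rewrite !memv_cap => /andP[/sU-> /sV->]. Qed.

Lemma stable_add U V : stable U -> stable V -> stable (U + V).
Proof.
by move=> sU sV i _ /memv_addP[u uU [v vV ->]]; rewrite linearD memv_add ?sU ?sV.
Qed.

Lemma stable_img V T : stable V -> equivariant V T -> stable (T @: V).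
Proof. by move=> sV eT i _ /memv_imgP[v vV ->]; rewrite -eT // memv_img ?sV. Qed.

Lemma stable_ker V T : stable V -> equivariant V T -> stable (V :&: lker T).
Proof.
move=> sV eT i v; rewrite !memv_cap !memv_ker => /andP[vV /eqP Tv].
by rewrite sV // eT // Tv linear0 eqxx.
Qed.

Lemma simple_exists U : stable U -> U != 0%VS ->
  exists2 V, simple V & (V <= U)%VS.
Proof.
move=> sU U0; pose Q n := `[< exists V, [/\ stable V, V != 0%VS, (V <= U)%VS &
  \dim V = n] >].
have Q0 : exists n, Q n by exists (\dim U); apply/asboolP; exists U.
case: (ex_minnP Q0) => n /asboolP[V [sV V0 VU dV]] minn.
exists V => //; split=> // W sW WV W0; apply/eqP; rewrite eqEdim WV dV minn //.
by apply/asboolP; exists W; split=> //; apply: subv_trans VU.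
Qed.

Lemma simple_cap V U : simple V -> stable U -> (V :&: U)%VS != 0%VS -> (V <= U)%VS.
Proof.
by case=> sV _ mV sU /mV <-; rewrite ?capvSr ?capvSl //; apply: stable_cap.
Qed.

Lemma simple_inj V T : simple V -> equivariant V T -> (T @: V)%VS != 0%VS ->
  (V :&: lker T)%VS = 0%VS.
Proof.
case=> sV _ mV eT TV0; apply/eqP; apply: contraNT TV0 => /mV kV.
by rewrite -lkerE -(kV _ (capvSl _ _)) ?capvSr //; apply: stable_ker.
Qed.

(** A stable nonzero [U] inside the image pulls back to a stable nonzero subspace of [V], which is
    all of [V]. *)
Lemma simple_img V T : simple V -> equivariant V T -> (T @: V)%VS != 0%VS ->
  simple (T @: V).
Proof.
move=> simV eT TV0; have [sV V0 mV] := simV.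
split=> // [|U sU UTV U0]; first exact: stable_img.
have sW : stable (V :&: (T @^-1: U)).
  move=> i v; rewrite !memv_cap -!memv_preim => /andP[vV vU].
  by rewrite sV // eT // sU.
apply/eqP; rewrite eqEsubv UTV /=; apply/subvP=> _ /memv_imgP[v vV ->].
have : v \in (V :&: (T @^-1: U))%VS; last by rewrite memv_cap -memv_preim => /andP[].
rewrite (mV _ sW) ?capvSl //; apply: contraNneq U0 => W0; rewrite -subv0.
apply/subvP=> u uU; have /memv_imgP[w wV uE] := subvP UTV _ uU.
have : w \in (V :&: (T @^-1: U))%VS by rewrite memv_cap -memv_preim wV -uE.
by rewrite W0 memv0 uE => /eqP->; rewrite linear0 mem0v.
Qed.

Lemma simple_socle V : simple V -> (V <= socle)%VS.
Proof.
move=> sV; apply/subvP=> v vV; apply/sumv_familyP; exists [:: V].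
  by move=> U; rewrite inE => /eqP->.
by rewrite big_seq1.
Qed.

Lemma socle_sub U : (forall V, simple V -> (V <= U)%VS) -> (socle <= U)%VS.
Proof.
move=> simU; apply/subvP=> v /sumv_familyP[Us PUs]; move: v; apply/subvP.
by rewrite big_seq; elim/big_ind: _ => [|A B AU BU|V /PUs/simU //];
  rewrite ?sub0v // subv_add AU.
Qed.

Lemma img_socle_sub T U :
  (forall V, simple V -> (T @: V <= U)%VS) -> (T @: socle <= U)%VS.
Proof.
move=> simU; apply/subvP=> _ /memv_imgP[v vS ->].
suff /subvP/(_ v vS) : (socle <= T @^-1: U)%VS by rewrite -memv_preim.
apply: socle_sub => V /simU TV; apply/subvP=> w wV; rewrite -memv_preim.
by apply: subvP TV _ _; rewrite memv_img.
Qed.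

Lemma stable_socle : stable socle.
Proof.
move=> i v vS; apply: subvP (_ : op i @: socle <= socle)%VS _ (memv_img _ vS).
apply: img_socle_sub => V simV; apply: subv_trans (simple_socle simV).
by have [sV _ _] := simV; apply/subvP=> _ /memv_imgP[w wV ->]; apply: sV.
Qed.

Lemma socle_equivariant T : (forall i v, T (op i v) = op i (T v)) ->
  (T @: socle <= socle)%VS.
Proof.
move=> eT; apply: img_socle_sub => V simV.
have [->|TV0] := eqVneq (T @: V)%VS 0%VS; first exact: sub0v.
by apply: simple_socle; apply: simple_img => // i v _.
Qed.

(** Take [W] of maximal dimension among the stable subspaces meeting [V] trivially. A simple [U]
    outside [V + W] would meet it trivially, and [W + U] would contradict maximality; so [V + W]
    contains the socle, and the projection onto [V] along [W] is the retraction. *)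
Lemma simple_retract V : simple V ->
  exists P : 'End(M), [/\ equivariant socle P, forall w, P w \in V &
    {in V, forall v, P v = v}].
Proof.
move=> simV; have [sV V0 _] := simV.
pose Q n := `[< exists W, [/\ stable W, (V :&: W = 0)%VS & \dim W = n] >].
have Q0 : exists n, Q n.
  exists 0%N; apply/asboolP; exists 0%VS; split; rewrite ?capv0 ?dimv0 //.
  by move=> i u; rewrite memv0 => /eqP->; rewrite linear0 mem0v.
have Qle n : Q n -> (n <= \dim {:M})%N.
  by case/asboolP=> W [_ _ <-]; rewrite dimvS ?subvf.
case: (ex_maxnP Q0 Qle) => n /asboolP[W [sW VW dW]] maxn.
have SVW : (socle <= V + W)%VS.
  apply: socle_sub => U simU; have [sU U0 _] := simU.
  apply: simple_cap (stable_add sV sW) _ => //; apply/eqP=> UVW.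
  have WU : (W :&: U = 0)%VS.
    by apply/eqP; rewrite -subv0 -UVW capvC capvS ?addvSr.
  suff /maxn : Q (\dim (W + U)).
    rewrite (dimv_disjoint_sum WU) dW -{2}[n]addn0 leq_add2l leqn0.
    by rewrite dimv_eq0 (negPf U0).
  apply/asboolP; exists (W + U)%VS; split=> //; first exact: stable_add.
  apply/eqP; rewrite -subv0; apply/subvP=> v; rewrite memv_cap memv0.
  case/andP=> vV /memv_addP[w wW [u uU vE]].
  have u0 : u = 0.
    apply/eqP; rewrite -memv0 -UVW memv_cap uU /= -[u](addKr w) -vE addrC.
    by rewrite memv_add ?memvN.
  by rewrite -memv0 -VW memv_cap vV vE u0 addr0.
have piW w : w \in W -> daddv_pi V W w = 0.
  move=> wW; apply/eqP; rewrite -(inj_eq (addIr (daddv_pi W V w))) add0r.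
  by rewrite daddv_pi_add ?(subvP (addvSr _ _)) // daddv_pi_id // capvC.
exists (daddv_pi V W); split=> [i s|w|v];
  [|exact: memv_pi|exact: daddv_pi_id].
case/(subvP SVW)/memv_addP=> v vV [w wW ->].
rewrite !linearD /= (piW _ wW) (piW _ (sW i _ wW)) !addr0.
by rewrite linear0 addr0 (daddv_pi_id VW vV) (daddv_pi_id VW (sV i _ vV)).
Qed.

End OperatorModules.

(** * Schur's lemma and multiplicities of simple submodules *)

Section Schur.
Variables (k : closedFieldType) (M : vectType k) (I : Type) (op : I -> 'End(M)).

(** If [T v = a *: T0 v] for a single nonzero [v] in [V], then the kernel of [T - a *: T0] on [V] is
    stable and nonzero, hence equals [V]. Such a [v] is an eigenvector of [T] followed by an inverse
    of [T0]. *)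
Lemma schur (V : {vspace M}) (T0 T : 'End(M)) :
    simple op V -> equivariant op V T0 -> equivariant op V T ->
    (V :&: lker T0)%VS = 0%VS -> (T @: V <= T0 @: V)%VS ->
  exists c, {in V, forall v, T v = c *: T0 v}.
Proof.
move=> [sV V0 mV] e0 e1 inj0 TV; pose F := (T0 \o projv V)%VF.
have FE u : T0 (projv V u) = F u by rewrite comp_lfunE.
(* On [V], [J v] is a preimage of [T v] under [T0] lying in [V]. *)
pose J := (projv V \o F^-1 \o T)%VF.
have JE v : v \in V -> T0 (J v) = T v.
  move=> vV; rewrite !comp_lfunE FE limg_lfunVK //.
  have /memv_imgP[w wV ->] := subvP TV _ (memv_img T vV).
  by rewrite -{1}(projv_id wV) FE memv_img ?memvf.
have [|a [v [vV v0 Jv]]] := @eigenvector_closed _ _ J V V0.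
  by apply/subvP=> _ /memv_imgP[v vV ->]; rewrite !comp_lfunE memv_proj.
exists a => w wV; suff /subvP/(_ w wV) : (V <= lker (T - a *: T0))%VS.
  by rewrite memv_ker !lfunE /= !lfunE /= subr_eq0 => /eqP->; rewrite lfunE.
rewrite -[X in (X <= _)%VS](mV (V :&: lker (T - a *: T0))%VS) ?capvSr ?capvSl //.
  apply: stable_ker => // i u uV; rewrite !(add_lfunE, opp_lfunE, scale_lfunE).
  by rewrite (e0 _ _ uV) (e1 _ _ uV) linearB /= [X in _ = _ - X]linearZ.
apply/negP=> /eqP z; move/eqP: v0; apply; apply/eqP; rewrite -memv0 -z.
rewrite memv_cap vV memv_ker !(add_lfunE, opp_lfunE, scale_lfunE).
by rewrite -JE // Jv [X in X - _]linearZ /= subrr eqxx.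
Qed.

(** [X] parametrises linearly independent equivariant maps from [V] to [U], so [U] should contain
    [\dim X] independent copies of [V]. The induction splits off one copy, the image of [J y0], by a
    retraction [P], and continues with the part of [U] killed by [P] and the [y] whose [J y] lands
    there. *)
Lemma multiplicity_bound (V : {vspace M}) (Y : vectType k)
    (J : {linear Y -> 'End(M)}) (X : {vspace Y}) (U : {vspace M}) :
    simple op V -> (U <= socle op)%VS ->
    {in X, forall y, equivariant op V (J y)} ->
    {in X, forall y, (J y @: V <= U)%VS} ->
    {in X, forall y, (J y @: V = 0)%VS -> y = 0} ->
  (\dim V * \dim X <= \dim U)%N.
Proof.
move=> simV; suff: forall n, (n <= \dim X)%N -> (U <= socle op)%VS ->
    {in X, forall y, equivariant op V (J y)} ->
    {in X, forall y, (J y @: V <= U)%VS} ->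
    {in X, forall y, (J y @: V = 0)%VS -> y = 0} ->
  (\dim V * n <= \dim U)%N by apply.
move=> n; elim: n => [|n IHn] in X U *; first by rewrite muln0.
move=> dX US eJ JU injJ; have [sV V0 mV] := simV.
set y0 := vpick X; have y0X : y0 \in X := memv_pick X.
have y00 : y0 != 0 by rewrite vpick0 -dimv_eq0 -lt0n (leq_trans _ dX).
have J0 : (J y0 @: V)%VS != 0%VS.
  by apply: contra_neq y00 => /injJ; apply.
have sim0 : simple op (J y0 @: V) by apply: simple_img; auto.
have inj0 := simple_inj simV (eJ _ y0X) J0.
have [P [eP PV P1]] := simple_retract sim0.
have PJ y : y \in X -> exists c, {in V, forall v, P (J y v) = c *: J y0 v}.
  move=> yX; have [||c cE] := @schur V (J y0) (P \o J y)%VF simV (eJ _ y0X) _ inj0.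
  - move=> i v vV; rewrite !comp_lfunE eJ // eP //.
    by rewrite (subvP US) ?(subvP (JU _ yX)) ?memv_img.
  - by apply/subvP=> _ /memv_imgP[v vV ->]; rewrite comp_lfunE PV.
  by exists c => v vV; rewrite -cE // comp_lfunE.
pose v0 := vpick V; have v0V : v0 \in V := memv_pick V.
have v00 : J y0 v0 != 0.
  have : v0 != 0 by rewrite vpick0.
  apply: contraNneq => Jv0; rewrite -memv0 -inj0 memv_cap v0V memv_ker Jv0 eqxx //.
pose g : 'Hom(Y, M) := linfun (fun y => P (J y v0)).
have gE y : g y = P (J y v0).
  have gl : linear (fun y => P (J y v0)).
    by move=> a y1 y2; rewrite linearP add_lfunE scale_lfunE linearP.
  pose gL : {linear Y -> M} := HB.pack (fun y => P (J y v0))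
    (GRing.isLinear.Build k Y M _ _ gl).
  by rewrite /g (_ : (fun y => P (J y v0)) = gL) // lfunE.
(* Schur: [P \o J y] is a multiple of [J y0] on [V], so [g] has rank one. *)
have gX : (\dim (g @: X) <= 1)%N.
  apply: (@leq_trans (\dim <[J y0 v0]>)); last by rewrite dim_vline leq_b1.
  apply: dimvS; apply/subvP=> _ /memv_imgP[y yX ->]; rewrite gE.
  by have [c ->] := PJ _ yX; rewrite ?memvZ ?memv_line.
have dX' : (n <= \dim (X :&: lker g))%N.
  by rewrite -(leq_add2r 1) addn1 (leq_trans dX) // -(limg_ker_dim g X) leq_add2l.
(* [P] fixes the copy [J y0 @: V] inside [U], so [P @: U] is at least as large as [V]. *)
have dPU : (\dim V <= \dim (P @: U))%N.
  rewrite -(limg_dim_eq inj0) dimvS //; apply/subvP=> w wV.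
  by rewrite -(P1 w wV) memv_img // (subvP (JU _ y0X)).
rewrite mulnS addnC -(limg_ker_dim P U) leq_add //.
have XE y : y \in (X :&: lker g)%VS -> y \in X /\ g y = 0.
  by rewrite memv_cap memv_ker => /andP[? /eqP].
apply: IHn dX' _ _ _ _.
- by apply: subv_trans US; apply: capvSl.
- by move=> y /XE[yX _]; apply: eJ.
(* As [J y0 v0] is nonzero, [g y = 0] forces the Schur scalar to vanish, and [J y] maps all of [V]
   into the kernel of [P]. *)
- move=> y /XE[yX gy]; rewrite subv_cap JU //=.
  apply/subvP=> _ /memv_imgP[v vV ->]; rewrite memv_ker.
  have [c cE] := PJ _ yX; rewrite cE //.
  have /eqP : c *: J y0 v0 = 0 by rewrite -cE // -gE.
  by rewrite scaler_eq0 (negPf v00) orbF => /eqP->; rewrite scale0r.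
- by move=> y /XE[yX _]; apply: injJ.
Qed.

End Schur.

(** * Left coideals *)

Section TensorCalculus.
Variable K : fieldType.
Implicit Types U V W : vectType K.

Definition bilin U V W (F : U -> V -> W) :=
  (forall v, linear (F^~ v)) /\ (forall u, linear (F u)).

Lemma tlift_comp U V W W' (g : {linear W -> W'}) (F : U -> V -> W) t :
  g (tlift F t) = tlift (fun u v => g (F u v)) t.
Proof.
rewrite /tlift linear_sum; apply: eq_bigr => i _.
by rewrite linear_sum; apply: eq_bigr => j _; rewrite linearZ.
Qed.

Lemma eq_tlift U V W (F F' : U -> V -> W) :
  (forall u v, F u v = F' u v) -> tlift F =1 tlift F'.
Proof.
by move=> eF t; apply: eq_bigr => i _; apply: eq_bigr => j _; rewrite eF.
Qed.

Lemma tlift_add U V W (F F' : U -> V -> W) t :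
  tlift (fun u v => F u v + F' u v) t = tlift F t + tlift F' t.
Proof.
rewrite /tlift -big_split; apply: eq_bigr => i _ /=.
by rewrite -big_split; apply: eq_bigr => j _; rewrite scalerDr.
Qed.

Lemma tlift_scale U V W (F : U -> V -> W) c t :
  c *: tlift F t = tlift (fun u v => c *: F u v) t.
Proof. exact: (tlift_comp (GRing.scale c)). Qed.

Lemma tlift_tmap U V U' V' W (F : U' -> V' -> W) (f : U -> U') (g : V -> V') t :
  bilin F -> tlift F (tmap f g t) = tlift (fun u v => F (f u) (g v)) t.
Proof.
by case=> Fl Fr; rewrite /tmap tlift_comp; apply: eq_tlift => u v; apply: tlift_tens.
Qed.

Lemma tlift_linear_in U V W (X : vectType K) (F : X -> U -> V -> W) t :
  (forall u v, linear (fun x => F x u v)) -> linear (fun x => tlift (F x) t).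
Proof.
move=> linF a x y; rewrite /tlift scaler_sumr -big_split; apply: eq_bigr => i _ /=.
rewrite scaler_sumr -big_split; apply: eq_bigr => j _ /=.
by rewrite linF scalerDr !scalerA mulrC.
Qed.

Definition cofun V i : 'Hom(V, K^o) :=
  linfun (coord (vbasis {:V}) i : V -> K^o).

Lemma cofunE V i (v : V) : cofun i v = coord (vbasis {:V}) i v.
Proof. by rewrite lfunE. Qed.

Lemma functional_ext V (v w : V) : (forall f : 'Hom(V, K^o), f v = f w) -> v = w.
Proof.
move=> fvw; rewrite (ebasis_sum v) (ebasis_sum w); apply: eq_bigr => i _.
by have := fvw (cofun i); rewrite !cofunE => ->.
Qed.

Lemma functional_exists V (U : {vspace V}) v :
  v \notin U -> exists f : 'Hom(V, K^o), (forall u, u \in U -> f u = 0) /\ f v != 0.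
Proof.
move=> vU; pose q := (\1 - projv U)%VF.
have [i ci] : exists i, coord (vbasis {:V}) i (q v) != 0.
  apply/existsP; apply: contraNT vU; rewrite negb_exists => /forallP c0.
  have : q v = 0.
    rewrite (ebasis_sum (q v)) big1 // => i _.
    by have /negbNE/eqP-> := c0 i; rewrite scale0r.
  rewrite add_lfunE opp_lfunE id_lfunE => /eqP; rewrite subr_eq0 => /eqP->.
  exact: memv_proj.
exists (cofun i \o q)%VF; split=> [u uU|].
  rewrite comp_lfunE add_lfunE opp_lfunE id_lfunE projv_id // subrr.
  by rewrite linear0.
by rewrite comp_lfunE cofunE.
Qed.

(** Coordinate functionals on the first factor recover the rows of the coordinate matrix. Identities
    in [tprod C C] can thus be tested through [Rop]. *)
Lemma tensor_ext U V (s t : tprod U V) :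
    (forall f : 'Hom(U, K^o),
       tlift (fun u v => (f u : K) *: v) s = tlift (fun u v => (f u : K) *: v) t) ->
  s = t.
Proof.
have fB W : free (vbasis {:W}) by apply: basis_free (vbasisP _).
have E (r : tprod U V) i j : (r : 'M_(_, _)) i j =
    coord (vbasis {:V}) j (tlift (fun u v => (cofun i u : K) *: v) r).
  rewrite [tlift _ _](_ : _ = \sum_l (r : 'M_(_, _)) i l *: ebasis l).
    by rewrite /ebasis coord_sum_free.
  rewrite /tlift (bigD1 i) //= [X in _ + X]big1 => [|i1 i1i].
    rewrite addr0; apply: eq_bigr => l _.
    by rewrite cofunE coord_free // eqxx scale1r.
  apply: big1 => l _; rewrite cofunE coord_free //.
  by rewrite -[_ == _]/(i1 == i) (negPf i1i) scale0r scaler0.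
by move=> eqst; apply/matrixP=> i j; rewrite !E eqst.
Qed.

Lemma memv_tens U V (X : {vspace U}) (Y : {vspace V}) x y :
  x \in X -> y \in Y -> tens x y \in tprodv X Y.
Proof.
move=> xX yY.
pose L v : {linear U -> tprod U V} := HB.pack (fun u => tens u v)
  (GRing.isLinear.Build K U (tprod U V) _ _ (tens_linearl v)).
pose R u : {linear V -> tprod U V} := HB.pack (tens u)
  (GRing.isLinear.Build K V (tprod U V) _ _ (tens_linearr u)).
rewrite -[tens x y]/(L y x) (coord_vbasis xX) linear_sum memv_suml // => i _.
rewrite linearZ memvZ //= -[tens _ y]/(R _ y) (coord_vbasis yY) linear_sum.
rewrite memv_suml // => j _; rewrite linearZ memvZ //=.
apply: memv_span; apply/allpairsP; exists ((vbasis X)`_i, (vbasis Y)`_j).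
by rewrite !mem_nth ?size_tuple.
Qed.

Lemma memv_tlift U V W (F : U -> V -> W) (X : {vspace U}) (Y : {vspace V})
    (Z : {vspace W}) t :
  bilin F -> (forall u v, u \in X -> v \in Y -> F u v \in Z) ->
  t \in tprodv X Y -> tlift F t \in Z.
Proof.
case=> Fl Fr XYZ tXY.
suff /subvP/(_ t tXY) : (tprodv X Y <= linfun (tlift F) @^-1: Z)%VS.
  by rewrite -memv_preim lfunE.
apply/span_subvP=> _ /allpairsP[[u v] /= [uX vY ->]].
by rewrite -memv_preim lfunE /= tlift_tens // XYZ ?vbasis_mem.
Qed.

End TensorCalculus.

(** * The two commuting actions of the dual space on a coalgebra *)

Section CoalgebraActions.
Variables (K : fieldType) (C : coalgType K).
Implicit Types (f g : 'Hom(C, K^o)) (h : C) (D : {vspace C}).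

(* [Rop f h] is f(h1)h2 and [Lop f h] is h1 f(h2) in Sweedler notation, so the
   [Rop]-stable subspaces are the left coideals. *)
Definition Rop f : 'End(C) :=
  linfun (tlift (fun a b : C => (f a : K) *: b) \o comul).
Definition Lop f : 'End(C) :=
  linfun (tlift (fun a b : C => (f b : K) *: a) \o comul).

Definition coeps : 'Hom(C, K^o) := linfun counit.

Lemma coepsE h : coeps h = counit h.
Proof. by rewrite lfunE. Qed.

Lemma RopE f h : Rop f h = tlift (fun a b : C => (f a : K) *: b) (comul h).
Proof. by rewrite lfunE. Qed.

Lemma LopE f h : Lop f h = tlift (fun a b : C => (f b : K) *: a) (comul h).
Proof. by rewrite lfunE. Qed.

(** Both sides are f(h1)g(h2). With [functional_ext] this carries statements about [Lop] over to
    [Rop] and back. *)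
Lemma pairing_Lop f g h : f (Lop g h) = g (Rop f h).
Proof.
rewrite LopE RopE !tlift_comp; apply: eq_tlift => u v.
by rewrite !linearZ; apply: mulrC.
Qed.

Lemma Lop_linear : linear Lop.
Proof.
move=> a f g; apply/lfunP=> h; apply: functional_ext => u.
rewrite pairing_Lop !(add_lfunE, scale_lfunE) linearD linearZ /=.
by rewrite !pairing_Lop.
Qed.

HB.instance Definition _ := GRing.isLinear.Build K 'Hom(C, K^o) 'End(C) _ Lop
  Lop_linear.

Lemma coeps_Rop f h : coeps (Rop f h) = f h.
Proof.
rewrite RopE tlift_comp -[h in RHS]comul_counitr tlift_comp.
by apply: eq_tlift => u v; rewrite !linearZ /= coepsE; apply: mulrC.
Qed.

Lemma Lop_coeps h : Lop coeps h = h.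
Proof.
rewrite LopE -[RHS]comul_counitr; apply: eq_tlift => u v.
by rewrite coepsE.
Qed.

Lemma coeps_Lop f h : coeps (Lop f h) = f h.
Proof.
rewrite LopE tlift_comp -[h in RHS]comul_counitl tlift_comp.
by apply: eq_tlift => u v; rewrite !linearZ /= coepsE; apply: mulrC.
Qed.

(** Both sides are f(h1) h2 g(h3): this is coassociativity read through [G], which stands for f ⊗ id
    ⊗ g. It makes every [Lop g] equivariant for the family [Rop]. *)
Lemma Rop_Lop f g h : Rop f (Lop g h) = Lop g (Rop f h).
Proof.
pose G : {linear tprod C (tprod C C) -> C} := tlift (fun (a : C) (t : tprod C C) =>
   tlift (fun b c : C => (f a * g c : K) *: b) t).
have bG : bilin (fun (a : C) (t : tprod C C) =>
    tlift (fun b c : C => (f a * g c : K) *: b) t).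
  split=> [t|a]; last exact: linearP.
  apply: tlift_linear_in => u v s x y.
  by rewrite linearP mulrDl scalerDl !scalerA -mulrA.
have Gtens a b c : G (tens a (tens b c)) = (f a * g c : K) *: b.
  rewrite /G /= tlift_tens; [|by case: bG..].
  rewrite tlift_tens // => [c'|b'] s u v /=.
    by rewrite scalerDr !scalerA [s * _]mulrC.
  by rewrite linearP mulrDr scalerDl !scalerA /= mulrCA.
have := congr1 G (comulA h); rewrite [G (tmap _ _ _)]tlift_tmap //.
rewrite /tassoc tlift_tmap; last first.
  split=> [w|t]; first exact: linearP.
  apply: tlift_linear_in => u v s x y.
  by rewrite tens_linearr tens_linearr.
rewrite tlift_comp => eqG.
transitivity (tlift (fun a b : C => (g b : K) *: Rop f a) (comul h)).
  by rewrite LopE tlift_comp; apply: eq_tlift => a b; rewrite linearZ.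
rewrite RopE tlift_comp.
transitivity (tlift (fun a b => (f a : K) *: Lop g b) (comul h)).
  move: eqG; congr (_ = _); apply: eq_tlift => a b.
    rewrite tlift_comp RopE tlift_scale; apply: eq_tlift => u v.
    by rewrite Gtens scalerA mulrC.
  rewrite LopE tlift_scale; apply: eq_tlift => u v.
  by rewrite scalerA.
by apply: eq_tlift => a b; rewrite linearZ.
Qed.

Lemma bilin_scalel f : bilin (fun a b : C => (f a : K) *: b).
Proof.
split=> [v|u] s x y /=; last by rewrite scalerDr !scalerA mulrC.
by rewrite linearP scalerDl -scalerA.
Qed.

Lemma bilin_scaler f : bilin (fun a b : C => (f b : K) *: a).
Proof.
split=> [v|u] s x y /=; first by rewrite scalerDr !scalerA mulrC.
by rewrite linearP scalerDl -scalerA.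
Qed.

Lemma subcoalgebra_Rop D : subcoalgebra D -> stable Rop D.
Proof.
move=> sD f x /sD; rewrite RopE; apply: memv_tlift (bilin_scalel f) _ => u v _.
exact: memvZ.
Qed.

Lemma subcoalgebra_Lop D : subcoalgebra D -> stable Lop D.
Proof.
move=> sD f x /sD; rewrite LopE; apply: memv_tlift (bilin_scaler f) _ => u v.
by move=> uD _; apply: memvZ.
Qed.

Lemma eq_Lop D f g : stable Rop D -> {in D, f =1 g} -> {in D, Lop f =1 Lop g}.
Proof.
move=> sD fg h hD; apply: functional_ext => e.
by rewrite !pairing_Lop fg ?sD.
Qed.

(** It suffices that q ⊗ q fixes [comul x], where q projects onto [D]. Testing the first factor with
    [f], stability under [Rop] removes the outer q; pairing with [g], stability under [Lop] removes
    the inner one. *)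
Lemma stable_subcoalgebra D : stable Rop D -> stable Lop D -> subcoalgebra D.
Proof.
move=> sR sL x xD; pose q := projv D.
suff <- : tmap q q (comul x) = comul x.
  apply: memv_suml => i _; apply: memv_suml => j _; apply: memvZ.
  by apply: memv_tens; apply: memv_proj.
apply: tensor_ext => f; rewrite (tlift_tmap _ _ _ (bilin_scalel f)).
transitivity (q (Rop (f \o q)%VF x)).
  rewrite RopE tlift_comp; apply: eq_tlift => u v.
  by rewrite linearZ comp_lfunE.
rewrite -RopE projv_id ?sR //; apply: functional_ext => g.
by rewrite -!pairing_Lop comp_lfunE projv_id ?sL.
Qed.

(** The counit of [Rop f v] is [f v], so any [f] not vanishing at a vector [v] of [D] gives an
    element of nonzero counit. *)
Lemma coeps_neq0 D : stable Rop D -> D != 0%VS -> exists2 v, v \in D & coeps v != 0.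
Proof.
move=> sD D0; pose v := vpick D; have vD : v \in D := memv_pick D.
have [|f [_ fv]] := @functional_exists K C 0%VS v; first by rewrite memv0 vpick0.
by exists (Rop f v); rewrite ?sD ?coeps_Rop.
Qed.

Lemma socle_Lop : stable Lop (socle Rop).
Proof.
move=> f v vS; apply: subvP (_ : Lop f @: socle Rop <= socle Rop)%VS _ (memv_img _ vS).
by apply: socle_equivariant => g h; rewrite Rop_Lop.
Qed.

(** The socle is stable under both actions, so it meets a simple subcoalgebra [D] in a subcoalgebra.
    The intersection is nonzero because [D] contains a simple left coideal; hence it is all of
    [D]. *)
Lemma coradical_sub_socle : (coradical C <= socle Rop)%VS.
Proof.
suff sim D : simple_subcoalgebra D -> (D <= socle Rop)%VS.
  apply/subvP=> v /sumv_familyP[Us PUs]; move: v; apply/subvP.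
  rewrite big_seq; elim/big_ind: _ => [|A B AU BU|V /PUs/sim //].
    exact: sub0v.
  by rewrite subv_add AU.
case=> sD /eqP D0 minD; set S := socle Rop.
have sDR := subcoalgebra_Rop sD.
have sDL := subcoalgebra_Lop sD.
have [V simV VD] := simple_exists sDR D0.
have sL : stable Lop S by apply: socle_Lop.
have [|DS0|<-] := minD (D :&: S)%VS _ (capvSl _ _); last exact: capvSr.
  by apply: stable_subcoalgebra; apply: stable_cap => //; apply: stable_socle.
have [_ /negP[]] := simV; rewrite -subv0 -DS0 subv_cap VD.
exact: simple_socle.
Qed.

End CoalgebraActions.

Arguments Rop {K C} f.
Arguments Lop {K C} f.
Arguments coeps {K C}.

(** * Multiplication by a primitive element *)

(** The hypothesis says that [T] embeds [D] in the quotient by [U], realised here as the image of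
    [q]. The functional is [e] composed with a left inverse of this embedding. *)
Lemma functional_extension (K : fieldType) (V : vectType K) (D U : {vspace V})
    (T : 'End(V)) (e : 'Hom(V, K^o)) :
    {in D, forall b, T b \in U -> b = 0} ->
  exists f : 'Hom(V, K^o), {in U, forall u, f u = 0} /\
    {in D, forall b, f (T b) = e b}.
Proof.
move=> injT; pose q := (\1 - projv U)%VF; pose t := (q \o T \o projv D)%VF.
have qE v : q v = v - projv U v by rewrite add_lfunE opp_lfunE id_lfunE.
exists (e \o projv D \o t^-1 \o q)%VF; split=> [u uU|b bD].
  by rewrite comp_lfunE qE projv_id // subrr linear0.
have tE d : d \in D -> t d = q (T d) by move=> dD; rewrite !comp_lfunE projv_id.
rewrite !comp_lfunE -tE //; set d := projv D _; congr (e _).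
have dD : d \in D by apply: memv_proj.
apply/eqP; rewrite -subr_eq0; apply/eqP/injT; first exact: memvB.
have : t d = t b.
  have <- : t (t^-1%VF (t b)) = t b by rewrite limg_lfunVK ?memv_img ?memvf.
  by rewrite /d !comp_lfunE projv_proj.
move/eqP; rewrite !tE // -subr_eq0 -!linearB /= qE subr_eq0 => /eqP->.
exact: memv_proj.
Qed.

Section PrimitiveFiltration.
Variables (K : fieldType) (H : hopfAlgType K) (x : H).
Hypothesis prim_x : primitive_elt x.
Implicit Types (f : 'Hom(H, K^o)) (D : {vspace H}).

Lemma tlift_comul_mulr (W : vectType K) (F : H -> H -> W) b : bilin F ->
  tlift F (comul (b * x)) =
  tlift (fun u v => F (u * x) v + F u (v * x)) (comul b).
Proof.
case=> Fl Fr; rewrite comulM /tmul tlift_comp; apply: eq_tlift => u v.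
rewrite prim_x linearD /=.
have bl : bilin (fun c d : H => tens (u * c) (v * d)).
  by split=> a s y z /=; rewrite mulrDr -scalerAr ?tens_linearl ?tens_linearr.
by case: bl => bl br; rewrite !tlift_tens // !mulr1 linearD /= !tlift_tens.
Qed.

Lemma amulrE (y v : H) : amulr y v = v * y.
Proof. by rewrite lfunE. Qed.

Lemma Lop_mulr f b : Lop f (b * x) = Lop f b * x + Lop (f \o amulr x)%VF b.
Proof.
rewrite !LopE (tlift_comul_mulr _ (bilin_scaler f)) tlift_add; congr (_ + _).
  rewrite -amulrE tlift_comp; apply: eq_tlift => u v.
  by rewrite linearZ /= amulrE.
by apply: eq_tlift => u v; rewrite comp_lfunE amulrE.
Qed.

Lemma Rop_mulr f b : Rop f (b * x) = Rop f b * x + Rop (f \o amulr x)%VF b.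
Proof.
rewrite !RopE (tlift_comul_mulr _ (bilin_scalel f)) tlift_add addrC; congr (_ + _).
  rewrite -amulrE tlift_comp; apply: eq_tlift => u v.
  by rewrite linearZ /= amulrE.
by apply: eq_tlift => u v; rewrite comp_lfunE amulrE.
Qed.

Lemma amulr_exprS f j :
  ((f \o amulr x) \o amulr (x ^+ j) = f \o amulr (x ^+ j.+1))%VF.
Proof. by apply/lfunP=> v; rewrite !comp_lfunE !amulrE exprSr mulrA. Qed.

(** In the binomial expansion of the coproduct, [Lop f (b * x ^ n)] is the sum of the terms C(n,i)
    b1 x^i f(b2 x^(n-i)), with b2 in [D]. For n = j only i = 0 survives; [Lop_exprS] treats n = j +
    1, where i = 1 also survives, with coefficient j + 1. *)
Lemma Lop_expr D f b j : stable Rop D -> b \in D ->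
    (forall i d, (i < j)%N -> d \in D -> f (d * x ^+ i) = 0) ->
  Lop f (b * x ^+ j) = Lop (f \o amulr (x ^+ j))%VF b.
Proof.
move=> sD bD; elim: j f => [|j IHj] f f0.
  rewrite mulr1; congr (Lop _ _); apply/lfunP=> v.
  by rewrite comp_lfunE amulrE mulr1.
rewrite exprSr mulrA Lop_mulr IHj => [|i d ij]; last by apply: f0; apply: ltnW.
rewrite (@eq_Lop _ _ D _ 0 sD) => [||//]; last first.
  by move=> d dD; rewrite comp_lfunE amulrE f0 // zero_lfunE.
rewrite linear0 zero_lfunE mul0r add0r IHj => [|i d ij dD].
  by rewrite amulr_exprS -exprSr.
by rewrite comp_lfunE amulrE -mulrA -exprSr f0.
Qed.

Lemma Lop_exprS D f b j : stable Rop D -> b \in D ->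
    (forall i d, (i < j)%N -> d \in D -> f (d * x ^+ i) = 0) ->
  Lop f (b * x ^+ j.+1) =
  j.+1%:R *: (Lop (f \o amulr (x ^+ j))%VF b * x) +
    Lop (f \o amulr (x ^+ j.+1))%VF b.
Proof.
move=> sD bD; elim: j f => [|j IHj] f f0.
  rewrite !expr1 expr0 Lop_mulr scale1r; congr (Lop _ _ * _ + _).
  by apply/lfunP=> v; rewrite comp_lfunE amulrE mulr1.
rewrite exprSr mulrA Lop_mulr (Lop_expr sD bD f0) IHj; last first.
  by move=> i d ij dD; rewrite comp_lfunE amulrE -mulrA -exprSr f0.
by rewrite !amulr_exprS addrA -[X in X + _ + _]scale1r -scalerDl -exprSr -mulrS.
Qed.

Definition filt D m : {vspace H} := (\sum_(i < m) amulr (x ^+ i) @: D)%VS.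

Lemma memv_filt D m i d : (i < m)%N -> d \in D -> d * x ^+ i \in filt D m.
Proof.
move=> im dD; apply: subvP (sumv_sup (Ordinal im) isT (subvv _)) _ _.
by rewrite -amulrE memv_img.
Qed.

Variable p : nat.
Hypothesis char_p : p \in [pchar K].

(** This makes the sum of the [D * x ^ i] with [i < p] direct. A relation of degree at least two is
    turned by [Lop] of a suitable functional into one of degree one, which is excluded by
    hypothesis. *)
Lemma filt_inj D : stable Rop D -> stable Lop D ->
    {in D, forall b, b * x \in D -> b = 0} ->
  forall m, (m < p)%N -> {in D, forall b, b * x ^+ m \in filt D m -> b = 0}.
Proof.
move=> sR sL inj1; elim=> [|m IHm] mp b bD.
  by rewrite /filt big_ord0 memv0 mulr1 => /eqP.
case: m IHm mp => [|m] IHm mp bx.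
  move: bx; rewrite /filt big_ord1 => /memv_imgP[d dD].
  by rewrite amulrE mulr1 => bx; apply: inj1; rewrite // -[x]expr1 bx.
(* [f] kills the [d * x ^+ i] with [i <= m] and maps [d * x ^+ m.+1] to
   [coeps d], so [Lop f] sends [b * x ^+ m.+2] to [m.+2%:R *: (b * x)]
   modulo [D]. *)
have [|f [f0 fe]] :=
    @functional_extension _ _ D (filt D m.+1) (amulr (x ^+ m.+1)) coeps.
  by move=> d dD; rewrite amulrE; apply: IHm dD; apply: ltnW.
have f0' i d : (i < m.+1)%N -> d \in D -> f (d * x ^+ i) = 0.
  by move=> im dD; apply: f0; apply: memv_filt.
have : Lop f (b * x ^+ m.+2) \in D.
  case/memv_sumP: bx => v vD ->; rewrite linear_sum memv_suml // => i _ /=.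
  have /memv_imgP[d dD ->] := vD i isT; rewrite amulrE (Lop_expr sR dD) ?sL //.
  by move=> j e ji; apply: f0'; apply: leq_trans ji _; rewrite -ltnS.
have fe' : {in D, (f \o amulr (x ^+ m.+1))%VF =1 coeps}.
  by move=> d dD; rewrite comp_lfunE fe.
rewrite (Lop_exprS sR bD f0') (eq_Lop sR fe') // Lop_coeps.
move/(memvB)=> /(_ _ (sL (f \o amulr (x ^+ m.+2))%VF _ bD)).
rewrite addrK => bxD; apply: inj1 => //.
(* The degree is positive and smaller than the characteristic, hence invertible. *)
have m0 : m.+2%:R != 0 :> K by rewrite -(dvdn_pcharf char_p) gtnNdvd.
by rewrite -[b * x]scale1r -(mulVf m0) -scalerA memvZ.
Qed.

Lemma dim_filt D : stable Rop D -> stable Lop D ->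
    {in D, forall b, b * x \in D -> b = 0} ->
  forall m, (m <= p)%N -> \dim (filt D m) = (m * \dim D)%N.
Proof.
move=> sR sL inj1; elim=> [|m IHm] mp; first by rewrite /filt big_ord0 dimv0.
have inj b := @filt_inj D sR sL inj1 m mp b.
rewrite /filt big_ord_recr /= -/(filt D m) dimv_disjoint_sum; last first.
  apply/eqP; rewrite -subv0; apply/subvP=> v /memv_capP[vF /memv_imgP[b bD vE]].
  by move: vF; rewrite memv0 vE amulrE => /inj->; rewrite ?mul0r.
rewrite IHm 1?ltnW // mulSn addnC limg_dim_eq //.
apply/eqP; rewrite -subv0; apply/subvP=> b /memv_capP[bD].
by rewrite memv_ker memv0 amulrE => /eqP bx; rewrite (inj b bD) // bx mem0v.
Qed.

Lemma coeps1 : coeps (1 : H) = 1.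
Proof. by rewrite coepsE counit1. Qed.

Lemma coeps_primitive : coeps x = 0.
Proof.
have [bl br] := bilin_scaler (@coeps K H).
have := Lop_coeps x; rewrite LopE prim_x linearD /= !tlift_tens // coeps1 scale1r.
move/(canRL (addKr _)); rewrite addNr => /eqP.
by rewrite scaler_eq0 oner_eq0 orbF => /eqP.
Qed.

Lemma stable_unit : stable Rop <[1 : H]>%VS /\ stable Lop <[1 : H]>%VS.
Proof.
split=> f _ /vlineP[c ->]; rewrite linearZ memvZ //= ?RopE ?LopE comul1.
  by have [l r] := bilin_scalel f; rewrite tlift_tens // memvZ ?memv_line.
by have [l r] := bilin_scaler f; rewrite tlift_tens // memvZ ?memv_line.
Qed.

Hypothesis x0 : x != 0.

Lemma unit_mulx : {in <[1 : H]>%VS, forall b, b * x \in <[1 : H]>%VS -> b = 0}.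
Proof.
move=> _ /vlineP[c ->] /vlineP[d]; rewrite -scalerAl mul1r => cx.
have d0 : d = 0.
  have := congr1 coeps cx; rewrite !linearZ /= coeps_primitive coeps1.
  by rewrite scaler0 => /esym; rewrite [_ *: _]mulr1.
have /eqP := cx; rewrite d0 scale0r scaler_eq0 (negPf x0) orbF => /eqP->.
by rewrite scale0r.
Qed.

Lemma expr_filt_unit m : (m < p)%N -> x ^+ m \notin filt <[1]>%VS m.
Proof.
move=> mp; have [sR sL] := stable_unit.
have := filt_inj sR sL unit_mulx mp (memv_line 1); rewrite mul1r => h.
by apply/negP=> /h /eqP; rewrite oner_eq0.
Qed.

(** In a left coideal the second factor w2 stays in [W], so w1 ⊗ w2 y = 0. Applying the antipode to
    the first factor and multiplying gives eps(w) y = 0, and [W] contains some w with eps(w)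
    nonzero. *)
Lemma annihilator_primitive (W : {vspace H}) y :
    stable Rop W -> W != 0%VS -> {in W, forall w, w * y = 0} -> y = 0.
Proof.
move=> sW W0 Wy; have [w wW ew] := coeps_neq0 sW W0.
apply/eqP; move: ew; apply: contraNT => y0.
have bF : bilin (fun a b : H => antipode a * b).
  split=> [v|u] s a b /=; first by rewrite linearP mulrDl -scalerAl.
  by rewrite mulrDr -scalerAr.
have tm : tmap idfun (amulr y) (comul w) = 0.
  apply: tensor_ext => f; rewrite (tlift_tmap _ _ _ (bilin_scalel f)) linear0.
  transitivity (Rop f w * y); last by rewrite Wy ?sW.
  rewrite RopE -amulrE tlift_comp; apply: eq_tlift => u v.
  by rewrite linearZ.
have : (counit w : K) *: y = 0.
  have := congr1 (amulr y) (antipodel w); rewrite linearZ /= !amulrE mul1r => <-.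
  transitivity (tlift (fun a b : H => antipode a * b) 0); last exact: linear0.
  rewrite -amulrE tlift_comp -tm (tlift_tmap _ _ _ bF); apply: eq_tlift => u v.
  by rewrite /= !amulrE mulrA.
by move/eqP; rewrite scaler_eq0 (negPf y0) orbF coepsE.
Qed.

End PrimitiveFiltration.

(** Each step multiplies by [x - a] for an eigenvalue [a] of right multiplication by [x] on [W],
    which lowers the dimension. Assuming only a bound [n] keeps the degree exact when the dimension
    drops by more than one or is already zero. *)
Lemma annihilating_poly (k : closedFieldType) (A : falgType k) (x : A)
    (W : {vspace A}) n :
    (\dim W <= n)%N -> {in W, forall w, w * x \in W} ->
  exists g : {poly k}, [/\ g \is monic, size g = n.+1 &
    {in W, forall w, w * horner_alg x g = 0}].
Proof.
elim: n W => [|n IHn] W dW Wx.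
  exists 1; rewrite monic1 size_poly1; split=> // w.
  move: dW; rewrite leqn0 dimv_eq0 => /eqP->; rewrite memv0 => /eqP->.
  by rewrite mul0r.
have aE y v : amulr y v = v * y :> A by rewrite lfunE.
have [a dW'] : exists a, (\dim (amulr (x - a%:A) @: W) <= n)%N.
  have [W0|W0] := eqVneq W 0%VS; first by exists 0; rewrite W0 limg0 dimv0.
  have [|a [w [wW w0 wx]]] := @eigenvector_closed _ _ (amulr x) W W0.
    by apply/subvP=> _ /memv_imgP[w wW ->]; rewrite aE Wx.
  exists a; rewrite -ltnS; apply: leq_trans dW.
  rewrite -(limg_ker_dim (amulr (x - a%:A)) W) -addn1 addnC leq_add2r.
  rewrite lt0n dimv_eq0; apply: contraNneq w0 => k0; rewrite -memv0 -k0.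
  by rewrite memv_cap wW memv_ker aE mulrBr -[w * x]aE wx -scalerAr mulr1 subrr eqxx.
have [|g [mg sg Wg]] := IHn _ dW'.
  move=> _ /memv_imgP[w wW ->]; rewrite aE.
  have -> : w * (x - a%:A) * x = amulr (x - a%:A) (w * x).
    by rewrite aE -!mulrA; congr (w * _); rewrite mulrBl mulrBr mulr_algl mulr_algr.
  by rewrite memv_img ?Wx.
exists (('X - a%:P) * g); split.
- by rewrite monicMl ?monicXsubC.
- by rewrite size_monicM ?monicXsubC ?monic_neq0 // size_XsubC sg.
- move=> w wW; rewrite rmorphM rmorphB /= horner_algX horner_algC mulrA.
  by rewrite -[w * _]aE Wg ?memv_img.
Qed.

(** * Dimension bounds for left coideals and injectivity on the socle *)

Section PrimitiveElement.
Variables (k : closedFieldType) (H : hopfAlgType k) (x : H) (p : nat).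
Hypotheses (prim_x : primitive_elt x) (x0 : x != 0) (char_p : p \in [pchar k]).

Lemma stable_mulr_dim (W : {vspace H}) :
  stable Rop W -> W != 0%VS -> {in W, forall w, w * x \in W} -> (p <= \dim W)%N.
Proof.
move=> sW W0 Wx; rewrite leqNgt; apply/negP=> Wp.
have [g [mg sg Wg]] := annihilating_poly (leqnn _) Wx.
have := annihilator_primitive sW W0 Wg.
(* Isolating the leading term, of coefficient one, puts [x ^+ \dim W] in the span of the lower
   powers of [x]. *)
rewrite /horner_alg /horner_morph horner_coef size_map_poly sg big_ord_recr /=.
rewrite !coef_map /= -[g`_(\dim W)]/(g`_(\dim W).+1.-1) -sg.
rewrite -[g`_(size g).-1]/(lead_coef g) (monicP mg).
move/addr0_eq/esym; rewrite scale1r mul1r => xE.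
have /negP[] := expr_filt_unit prim_x char_p x0 Wp.
rewrite xE memvN memv_suml // => i _; rewrite coef_map /= memv_filt //.
by apply/vlineP; eexists.
Qed.

Lemma simple_dim (V : {vspace H}) :
  simple Rop V -> \dim {:H} = (p ^ 2)%N -> (\dim V < p)%N.
Proof.
move=> simV dH; have VS := simple_socle simV.
have p2 := prime_gt1 (pcharf_prime char_p).
have sim1 : simple Rop <[1 : H]>%VS.
  split; [by have [] := stable_unit H| by rewrite -dimv_eq0 dim_vline oner_neq0|].
  move=> U sU U1 U0; apply/eqP; rewrite eqEdim U1 dim_vline oner_neq0 lt0n.
  by rewrite dimv_eq0.
have [P [eP P1 Pid]] := simple_retract sim1.
have [sV V0 _] := simV.
have Lf (f : 'Hom(H, k^o)) : equivariant Rop V (Lop f).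
  by move=> g v _; rewrite Rop_Lop.
have LS (f : 'Hom(H, k^o)) : (Lop f @: V <= socle Rop)%VS.
  by apply/subvP=> _ /memv_imgP[v vV ->]; apply: socle_Lop; apply: subvP VS _ vV.
(* If [P \o Lop f] is nonzero on [V], it embeds [V] in the line of [1], so [\dim V <= 1 < p].
   Otherwise every [Lop f] maps [V] into the kernel of [P], which does not contain [1]. *)
have [[f Pf]|noP] := EM (exists f : 'Hom(H, k^o), ((P \o Lop f) @: V != 0)%VS).
  have eF : equivariant Rop V (P \o Lop f)%VF.
    move=> g v vV; rewrite !comp_lfunE Lf // eP // (subvP (LS f)) ?memv_img //.
  rewrite -(limg_dim_eq (simple_inj simV eF Pf)) (leq_trans _ p2) // ltnS.
  apply: (@leq_trans (\dim <[1 : H]>)); last by rewrite dim_vline leq_b1.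
  by apply: dimvS; apply/subvP=> _ /memv_imgP[v vV ->]; rewrite comp_lfunE P1.
(* The dual basis of [V], extended to functionals on [H]; the maps [Lop f] with [f] in its span
   supply [\dim V] independent copies of [V]. *)
pose phi := [tuple linfun (coord (vbasis V) i : H -> k^o) | i < \dim V].
have phiE (i : 'I_(\dim V)) v : (phi`_i : 'Hom(H, k^o)) v = coord (vbasis V) i v.
  by rewrite -tnth_nth tnth_mktuple lfunE.
have phib (c : 'I_(\dim V) -> k) (j : 'I_(\dim V)) :
    (\sum_i c i *: phi`_i : 'Hom(H, k^o)) (vbasis V)`_j = c j.
  rewrite sum_lfunE (bigD1 j) //= big1 ?addr0 => [|i ij].
    rewrite scale_lfunE phiE coord_free ?(basis_free (vbasisP _)) // eqxx.
    exact: mulr1.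
  rewrite scale_lfunE phiE coord_free ?(basis_free (vbasisP _)) //.
  by rewrite -[_ == _]/(j == i) eq_sym (negPf ij) scaler0.
have free_phi : free phi.
  by apply/freeP=> c c0 i; rewrite -(phib c i) c0 zero_lfunE.
have dim_phi : \dim <<phi>> = \dim V by rewrite (eqP free_phi) size_tuple.
rewrite -ltn_sqr -dH -mulnn -{2}dim_phi.
apply: (@leq_ltn_trans (\dim (socle Rop :&: lker P))).
  have dim_bound := @multiplicity_bound k H _ Rop V 'Hom(H, k^o) Lop <<phi>>%VS
    (socle Rop :&: lker P)%VS simV.
  apply: dim_bound => [|f _|f _|f].
  - exact: capvSl.
  - exact: Lf.
  - rewrite subv_cap LS lkerE -limg_comp.
    by apply: contra_notT noP => ?; exists f.
  (* The counit of [Lop f v] is [f v], so [f] vanishes on the basis of [V]; these values are its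
     coordinates in [phi]. *)
  - move=> fphi f0; rewrite (coord_span fphi) big1 // => i _.
    rewrite -(phib (fun i => coord phi i f)) -(coord_span fphi).
    have : Lop f (vbasis V)`_i == 0.
      by rewrite -memv0 -f0 memv_img ?vbasis_mem ?mem_nth ?size_tuple.
    by rewrite -coeps_Lop => /eqP->; rewrite linear0 scale0r.
rewrite ltn_neqAle dimvS ?subvf // andbT; apply/negP=> dE.
have : (1 : H) \in (socle Rop :&: lker P)%VS.
  have /eqP-> : (socle Rop :&: lker P)%VS == fullv.
    by rewrite eqEdim subvf (eqP dE) leqnn.
  exact: memvf.
by rewrite memv_cap memv_ker Pid ?memv_line // oner_eq0 andbF.
Qed.

Lemma socle_mulr_inj : \dim {:H} = (p ^ 2)%N ->
  {in socle Rop, forall b : H, b * x \in socle Rop -> b = 0}.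
Proof.
move=> dH b bS bxS; set S := socle Rop in bS bxS.
have sS : stable Rop S := @stable_socle _ _ _ _.
(* The set of counterexamples together with 0; being a left coideal, it would contain a simple
   one. *)
pose E := (S :&: (amulr x @^-1: S))%VS.
have memE v : (v \in E) = (v \in S) && (v * x \in S).
  by rewrite memv_cap -memv_preim amulrE.
have sE : stable Rop E.
  move=> f v; rewrite !memE => /andP[vS vxS]; rewrite sS //=.
  by rewrite -[_ * x](addrK (Rop (f \o amulr x)%VF v)) -(Rop_mulr prim_x) memvB ?sS.
apply/eqP; rewrite -memv0; suff /eqP <- : E == 0%VS by rewrite memE bS.
apply/negP=> /negP E0; have [V simV VE] := simple_exists sE E0.
have [sV V0 _] := simV.
have VS : (V <= S)%VS := simple_socle simV.
have VxS v : v \in V -> v * x \in S by move/(subvP VE); rewrite memE => /andP[].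
have [P [eP PV Pid]] := simple_retract simV.
pose Psi := (P \o amulr x)%VF.
have PsiE v : Psi v = P (v * x) by rewrite comp_lfunE amulrE.
have [|a [w [wV w0 wa]]] := @eigenvector_closed _ _ Psi V V0.
  by apply/subvP=> _ /memv_imgP[v vV ->]; rewrite PsiE PV.
(* [T] kills [w], so [U] is a proper subspace of [V]. A functional vanishing on [U] but not on [V]
   is an eigenvector of the transpose of [Psi] for [a]. *)
pose T := (Psi - a *: \1)%VF; pose U := (T @: V)%VS.
have TE v : T v = P (v * x) - a *: v.
  by rewrite add_lfunE opp_lfunE scale_lfunE id_lfunE PsiE.
have TV v : v \in V -> T v \in V by move=> vV; rewrite TE memvB ?memvZ.
have [v0 v0V v0U] : exists2 v, v \in V & v \notin U.
  apply/subvPn; apply: contra_neqN w0 => VU; apply/eqP; rewrite -memv0.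
  have <- : (V :&: lker T)%VS = 0%VS.
    apply/eqP; rewrite -dimv_eq0 -leqn0 -(leq_add2r (\dim U)) limg_ker_dim.
    exact: dimvS.
  by rewrite memv_cap wV memv_ker TE -PsiE wa subrr eqxx.
have [f [fU fv0]] := functional_exists v0U.
have fx v : v \in V -> Lop f v * x = Lop f (T v).
  move=> vV; apply: functional_ext => g.
  transitivity ((g \o amulr x)%VF (Lop f v)); first by rewrite comp_lfunE amulrE.
  (* [T] fails to commute with [Rop g] only by the second term of [Rop_mulr], on which [P] is the
     identity. As [f] kills the image of [T], that term alone remains, and it equals the pairing of
     [g] with [Lop f v * x]. *)
  have RT : Rop g (T v) = T (Rop g v) + Rop (g \o amulr x)%VF v.
    rewrite !TE linearB /= [X in _ - X]linearZ /= -eP ?VxS // (Rop_mulr prim_x).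
    by rewrite linearD /= (Pid _ (sV _ _ vV)) addrAC.
  by rewrite !pairing_Lop RT linearD /= (fU (T _)) ?memv_img ?sV // add0r.
have eL : equivariant Rop V (Lop f) by move=> g v _; rewrite Rop_Lop.
have : (p <= \dim (Lop f @: V))%N.
  apply: stable_mulr_dim; first exact: stable_img.
    apply: contraNneq fv0 => W0; rewrite -coeps_Lop.
    have : Lop f v0 == 0 by rewrite -memv0 -W0 memv_img.
    by move/eqP->; rewrite linear0.
  by move=> _ /memv_imgP[v vV ->]; rewrite fx // memv_img ?TV.
rewrite leqNgt => /negP; apply; apply: leq_ltn_trans (simple_dim simV dH).
by rewrite -(limg_ker_dim (Lop f) V) leq_addl.
Qed.

End PrimitiveElement.

Theorem corollary4p5 (k : closedFieldType) (p : nat) (hp : p \in [pchar k])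
  (H : hopfAlgType k) (hdim : \dim {:H} = (p ^ 2)%N)
  (hprim : exists x : H, x != 0 /\ primitive_elt x) :
  (\dim (coradical H) <= p)%N.
Proof.
have [x [x0 prim_x]] := hprim.
apply: leq_trans (dimvS (coradical_sub_socle H)) _.
have p0 : (0 < p)%N := prime_gt0 (pcharf_prime hp).
(* After multiplication by [p], the left side is the dimension of the direct sum of the [S * x ^ i],
   [i < p], inside [H]. *)
rewrite -(leq_pmul2l p0) mulnn -hdim.
rewrite -(dim_filt prim_x hp (@stable_socle _ _ _ _) (@socle_Lop _ _)
  (socle_mulr_inj prim_x x0 hp hdim) (leqnn p)).
exact: dimvS (subvf _).
Qed.
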